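(* Let $C$ be a normal cone with nonempty interior $\operatorname{int}C$ in a real Banach space $(X,\|\cdot\|)$, let $\psi\in C^*\setminus\{0\}$, and $\Sigma=\{x\in\operatorname{int}C\mid\psi(x)=1\}$. Let $G$ be a relatively open subset of $\Sigma$ and let $g:G\to\Sigma$ be a nonexpansive map with respect to Hilbert's projective metric $d$ or Thompson's metric $\bar d$ (i.e. $d(g(x),g(y))\le d(x,y)$ for all $x,y\in G$, or $\bar d(g(x),g(y))\le\bar d(x,y)$ for all $x,y\in G$). Let $v\in G$ be a fixed point of $g$: $g(v)=v$. Assume: (A1) $g$ is semidifferentiable at $v$ with respect to $\psi^{-1}(0)$, with semidifferential $g'_v$; (A2) the map $\mathrm{Id}-g'_v:\psi^{-1}(0)\to\psi^{-1}(0)$ has Property (F); (A3) the fixed point of $g'_v:\psi^{-1}(0)\to\psi^{-1}(0)$ is unique: if $x\in\psi^{-1}(0)$ and $g'_v(x)=x$, then $x=0$. Then the fixed point of $g$ in $G$ is unique: if $w\in G$ and $g(w)=w$, then $w=v$.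
   Context: Cones: a subset $C\subset X$ is a cone if $tC\subset C$ for all $t\ge0$. It is proper if it is closed, convex and pointed ($C\cap(-C)=\{0\}$); it then defines the partial order $x\le y\iff y-x\in C$. It is normal if it is proper and there is a constant $M$ with $\|x\|\le M\|y\|$ whenever $0\le x\le y$. $C^*$ is the set of continuous linear forms $\psi$ on $X$ with $\psi(x)\ge0$ for all $x\in C$. Metrics: for $x,y\in\operatorname{int}C$, let $M(y/x)=\inf\{b\in\mathbb R\mid y\le bx\}$ and $m(y/x)=\sup\{a\in\mathbb R\mid ax\le y\}$. Hilbert's projective metric is $d(x,y)=\log M(y/x)-\log m(y/x)$ and Thompson's metric is $\bar d(x,y)=\max(\log M(y/x),-\log m(y/x))$. Semidifferentiability: a map $g:G\to Y$ ($G\subset X$, $v\in G$, $X,Y$ normed spaces) is semidifferentiable at $v$ with respect to a cone $K\subset X$ if $G$ contains a neighborhood of $v$ in $v+K$ and there is a continuous positively homogeneous map $h:K\to Y$ (i.e. $h(tx)=th(x)$ for $t>0$) such that $g(v+x)=g(v)+h(x)+o(\|x\|)$ as $x\to0$, $x\in K$. Such $h$ is unique and denoted $g'_v$. Here $K=\psi^{-1}(0)$, and $g'_v$ takes values in $\psi^{-1}(0)$ since $g$ takes values in $\Sigma$. Property (F): a map $\phi:D\to Y$, with $D\subset X$ and $X,Y$ Banach spaces, has Property (F) if every sequence $(x_j)_{j\ge1}$ in $D$ that is bounded in $X$ and satisfies $\phi(x_j)\to0$ has a subsequence that converges in $X$. *)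

(* Defs.v *)
From mathcomp Require Import all_boot all_order all_algebra.
From mathcomp Require Import all_classical all_reals all_analysis.
Set Implicit Arguments.
Unset Strict Implicit.
Unset Printing Implicit Defensive.
Import Order.TTheory GRing.Theory Num.Theory numFieldNormedType.Exports.
Local Open Scope classical_set_scope.
Local Open Scope ring_scope.

Section cones.
Context {R : realType} {X : normedModType R}.
Implicit Types (C : set X) (x y : X).

Definition is_cone C := forall (t : R) x, 0 <= t -> C x -> C (t *: x).

Definition proper_cone C :=
  [/\ is_cone C, closed C, convex_set C & C `&` [set - x | x in C] = [set 0]].

Definition cone_le C x y := C (y - x).

Definition normal_cone C := proper_cone C /\
  exists M : R, forall x y, cone_le C 0 x -> cone_le C x y -> `|x| <= M * `|y|.

Definition dual_cone C (psi : {linear X -> R^o}) :=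
  continuous psi /\ forall x, C x -> 0 <= psi x.

Definition slice C (psi : {linear X -> R^o}) := [set x | C° x /\ psi x = 1].

(* [gauge_sup C y x] is M(y/x) and [gauge_inf C y x] is m(y/x). The real-valued
   [inf] and [sup] (and [ln] below) take junk values on empty or unbounded sets
   (resp. nonpositive arguments); this does not happen for x, y in C° when C is
   proper and C° does not contain 0. *)
Definition gauge_sup C y x : R := inf [set b | cone_le C y (b *: x)].
Definition gauge_inf C y x : R := sup [set a | cone_le C (a *: x) y].

Definition hilbert_metric C x y : R :=
  ln (gauge_sup C y x) - ln (gauge_inf C y x).

Definition thompson_metric C x y : R :=
  Num.max (ln (gauge_sup C y x)) (- ln (gauge_inf C y x)).

Definition nonexpansive_on (G : set X) (d : X -> X -> R) (g : X -> X) :=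
  forall x y, G x -> G y -> d (g x) (g y) <= d x y.

End cones.

(* Partial maps are encoded as total functions together with their domain:
   only the values of [g] on [G], of [h] on [K] and of [phi] on [D] matter. *)
Section semidifferentiability.
Context {R : realType} {X Y : normedModType R}.

(* [semidifferential K G g v h]: the map g : G -> Y is semidifferentiable at v
   with respect to the cone K, with semidifferential h : K -> Y. *)
Definition semidifferential (K G : set X) (g : X -> Y) (v : X) (h : X -> Y) :=
  [/\ (\forall x \near within K (nbhs (0 : X)), G (v + x)),
      {within K, continuous h},
      (forall (t : R) x, 0 < t -> K x -> h (t *: x) = t *: h x) &
      forall x, g (v + x) - (g v + h x) =o_(x \near within K (nbhs (0 : X))) x].

Definition property_F (D : set X) (phi : X -> Y) :=
  forall u : nat -> X, (forall j, D (u j)) -> bounded_fun u ->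
    phi \o u @ \oo --> (0 : Y) ->
    exists2 k : nat -> nat, increasing_seq k & cvgn (u \o k).

End semidifferentiability.

(* Main.v *)
(** Suppose [w <> v] is another fixed point and let [p] be a point of the segment
    [[v, w]] close to [v]. The set of points of the slice whose distances to [v]
    and to [w] do not exceed those of [p] is convex, invariant under [g], and
    stays away from [v], because [p] is strictly closer to [w] than [v] is. For
    [0 < t < 1] the map [z |-> (1 - t) g(z) + t p] is a strict contraction of this
    set, so its iterates yield points [z] with [|g(z) - z|] arbitrarily small
    compared with [|z - v|]. Letting [p] tend to [v], the directions
    [(z - v) / |z - v|] are approximately fixed by the semidifferential; Property
    (F) extracts a limit, a unit vector fixed by it, which (A3) forbids.
    Straight segments of the slice need not be geodesics of Thompson's metric, but
    the argument does not need that. *)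
Require Import Defs.
From mathcomp Require Import all_boot all_order all_algebra.
From mathcomp Require Import all_classical all_reals all_analysis.
From mathcomp Require Import ring lra.
Set Implicit Arguments.
Unset Strict Implicit.
Unset Printing Implicit Defensive.
Import Order.TTheory GRing.Theory Num.Theory numFieldNormedType.Exports.
Local Open Scope classical_set_scope.
Local Open Scope ring_scope.

(** * The order defined by a proper cone, and its interior points *)

Section cone_order.
Context {R : realType} {X : normedModType R} {C : set X}.
Context (C_proper : proper_cone C).
Implicit Types (x y z : X) (a b c r t : R).

Lemma coneZ t x : 0 <= t -> C x -> C (t *: x).
Proof. by case: C_proper => CZ _ _ _; exact: CZ. Qed.

Lemma coneD x y : C x -> C y -> C (x + y).
Proof.
move=> Cx Cy; have [_ _ Cconv _] := C_proper.
have h0 : 0 <= (2^-1 : R) by lra.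
have h1 : (2^-1 : R) <= 1 by lra.
have := Cconv x y (Itv01 h0 h1); rewrite !inE => /(_ Cx Cy).
have -> : conv (Itv01 h0 h1) (x : convex_lmodType X) y = 2^-1 *: (x + y).
  have h2 : unstable.onem (2^-1) = 2^-1 :> R by rewrite /unstable.onem; lra.
  by rewrite /conv /= h2 scalerDr.
move=> /(@coneZ 2 _ (ler0n _ _)).
by rewrite scalerA divff ?scale1r// pnatr_eq0.
Qed.

Lemma cone_le_refl x : C 0 -> cone_le C x x.
Proof. by rewrite /cone_le subrr. Qed.

Lemma cone_le_trans y x z : cone_le C x y -> cone_le C y z -> cone_le C x z.
Proof. by move=> xy yz; have := coneD yz xy; rewrite addrA subrK. Qed.

Lemma cone_leD x y x' y' :
  cone_le C x y -> cone_le C x' y' -> cone_le C (x + x') (y + y').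
Proof. by move=> xy x'y'; have := coneD xy x'y'; rewrite addrACA -opprD. Qed.

Lemma cone_leZ c x y : 0 <= c -> cone_le C x y -> cone_le C (c *: x) (c *: y).
Proof. by move=> c0 xy; rewrite /cone_le -scalerBr; exact: coneZ. Qed.

Lemma cone_le_wZ a b x : a <= b -> C x -> cone_le C (a *: x) (b *: x).
Proof. by move=> ab Cx; rewrite /cone_le -scalerBl; apply: coneZ; rewrite ?subr_ge0. Qed.

(** The map [z |-> t^-1 *: (z - x)] is continuous and sends [x + t *: y] to [y], so near
    [x + t *: y] every [z] is [x] plus [t] times a point of [C]. *)
Lemma interiorZD_cone t x y : 0 < t -> C x -> C° y -> C° (x + t *: y).
Proof.
move=> t0 Cx Cy; rewrite /interior /=.
have h : (fun z => t^-1 *: (z - x)) @ (x + t *: y) --> t^-1 *: (x + t *: y - x).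
  by apply: cvgZl_tmp; apply: cvgB; [exact: cvg_id|exact: cvg_cst].
rewrite [X in _ --> _ *: (X - _)]addrC addrK scalerA mulVf ?gt_eqF// scale1r in h.
suff : \forall z \near x + t *: y, C z by [].
have : \forall z \near x + t *: y, C (t^-1 *: (z - x)) := h _ Cy.
apply: filterS => z Cz.
have -> : z = x + t *: (t^-1 *: (z - x)).
  by rewrite scalerA divff ?gt_eqF// scale1r addrC subrK.
by apply: coneD => //; apply: coneZ => //; exact: ltW.
Qed.

(** As [z] tends to [x], both [r^-1 *: ((1 + r) *: x - z)] and [r^-1 *: ((1 + r) *: z - x)] tend to
    the interior point [x]. This is how closeness in norm becomes closeness in the metrics. *)
Lemma near_cone_le x r : C° x -> 0 < r -> \forall z \near x,
  cone_le C z ((1 + r) *: x) /\ cone_le C x ((1 + r) *: z).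
Proof.
move=> Cx r0; have rx : r^-1 *: ((1 + r) *: x - x) = x.
  by rewrite -[X in _ - X]scale1r -scalerBl addrAC subrr add0r scalerA mulVf ?gt_eqF// scale1r.
have rz z : C (r^-1 *: z) -> C z.
  by move=> /(coneZ (ltW r0)); rewrite scalerA divff ?gt_eqF// scale1r.
have h1 : (fun z => r^-1 *: ((1 + r) *: x - z)) @ x --> x.
  by rewrite -[X in _ --> X]rx; apply: cvgZl_tmp; apply: cvgB; [exact: cvg_cst|exact: cvg_id].
have h2 : (fun z => r^-1 *: ((1 + r) *: z - x)) @ x --> x.
  by rewrite -[X in _ --> X]rx; apply: cvgZl_tmp; apply: cvgB; [apply: cvgZl_tmp; exact: cvg_id|exact: cvg_cst].
have k1 : \forall z \near x, C (r^-1 *: ((1 + r) *: x - z)) := h1 _ Cx.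
have k2 : \forall z \near x, C (r^-1 *: ((1 + r) *: z - x)) := h2 _ Cx.
by apply: filterS2 k1 k2 => z /rz Cz1 /rz Cz2.
Qed.

(** For small [t > 0] the point [x - t *: y] stays in [C]; take [b = t^-1]. Hence the infimum M(y/x)
    is over a nonempty set. *)
Lemma cone_absorb x y : C° x -> exists2 b, 0 < b & cone_le C y (b *: x).
Proof.
move=> Cx.
have h : (fun t : R => x - t *: y) @ 0 --> x.
  rewrite -[X in _ --> X]subr0 -[X in _ --> _ - X](scale0r y).
  by apply: cvgB; [exact: cvg_cst|apply: cvgZr_tmp; exact: cvg_id].
have /= /nbhs_ballP[e /= e0] := h _ Cx => be.
have := be (e / 2); rewrite /ball /= sub0r normrN gtr0_norm ?divr_gt0// => /(_ _)/= C2.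
exists (e / 2)^-1; first by rewrite invr_gt0 divr_gt0.
have /C2 : e / 2 < e by lra.
move=> /(@coneZ (e / 2)^-1 _); rewrite scalerBr scalerA.
rewrite mulVf ?scale1r; last by rewrite gt_eqF ?divr_gt0.
apply; rewrite invr_ge0; lra.
Qed.

End cone_order.
(* The Funk metric [log M(y/x)]: Hilbert's metric is its symmetrization by sum,
   Thompson's its symmetrization by maximum. *)
Definition funk_metric {R : realType} {X : normedModType R} (C : set X) (x y : X) : R :=
  ln (gauge_sup C y x).

(** * The Funk metric on the slice *)

Section funk_metric_theory.
Context {R : realType} {X : normedModType R} {C : set X} {psi : {linear X -> R^o}}.
Context (C_proper : proper_cone C) (psi_dual : dual_cone C psi).
Implicit Types (x y z : X) (a b c r t : R).

Local Notation Sigma := (slice C psi).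
Local Notation F := (funk_metric C).

Lemma slice_cone x : Sigma x -> C x.
Proof. by case=> Cx _; exact: interior_subset. Qed.

(** Apply [psi] to [b *: x - y]. On the slice this gives M(y/x) >= 1, which keeps [ln] away from its
    default values and the Funk metric nonnegative. *)
Lemma slice_le1 x y b : Sigma x -> Sigma y -> cone_le C y (b *: x) -> 1 <= b.
Proof.
move=> [_ px] [_ py] /(proj2 psi_dual).
rewrite linearB linearZ px py => h.
by have : 0 <= b * 1 - 1 := h; rewrite mulr1 subr_ge0.
Qed.

Lemma slice_conv t x y : 0 < t <= 1 -> C x -> psi x = 1 -> Sigma y ->
  Sigma ((1 - t) *: x + t *: y).
Proof.
move=> /andP[t0 t1] Cx px [Cy py]; split.
  by apply: interiorZD_cone => //; apply: coneZ => //; rewrite subr_ge0.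
rewrite linearD !linearZ px py.
have e : (1 - t) * 1 + t * 1 = 1 by ring.
exact: e.
Qed.

(** The infimum is attained: [(M + e) *: x - y] lies in [C] for all [e > 0], and [C] is closed.
    Bounds on the gauge thus become cone inequalities. *)
Lemma gauge_sup_le x y b : Sigma x -> Sigma y ->
  gauge_sup C y x <= b <-> cone_le C y (b *: x).
Proof.
move=> Sx Sy; have Cx := slice_cone Sx.
have lb : lbound [set b | cone_le C y (b *: x)] 1 by move=> c /=; exact: slice_le1.
split=> [yb|]; last by move=> yb; apply: ge_inf => //; exists 1.
have [b0 b00 yb0] := cone_absorb C_proper y (proj1 Sx).
have hi : has_inf [set b | cone_le C y (b *: x)] by split; [exists b0|exists 1].
set M := gauge_sup C y x in yb.
have Me e : 0 < e -> C ((M + e) *: x - y).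
  move=> /inf_adherent/(_ hi)[c yc cM].
  by apply: (cone_le_trans C_proper yc); apply: cone_le_wZ => //; exact: ltW.
apply: (@cone_le_trans _ _ _ C_proper (M *: x)); last exact: cone_le_wZ.
have [_ Ccl _ _] := C_proper.
have lim : (M + e) *: x - y @[e --> 0^'+] --> (M + 0) *: x - y.
  apply: cvgB; last exact: cvg_cst.
  apply: cvgZr_tmp; apply: cvgD; first exact: cvg_cst.
  exact: cvg_at_right_filter cvg_id.
rewrite /cone_le -[M]addr0; apply: (closed_cvg _ Ccl _ _ lim).
by near=> e; apply: Me; near: e; exact: nbhs_right_gt.
Unshelve. all: by end_near. Qed.

Lemma gauge_sup_ge1 x y : Sigma x -> Sigma y -> 1 <= gauge_sup C y x.
Proof. by move=> Sx Sy; apply: (slice_le1 Sx Sy); apply/gauge_sup_le. Qed.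

(** For [a > 0], [a *: x <= y] means [x <= a^-1 *: y], so the two extremal problems are reciprocal.
    Both metrics can then be written with [funk_metric] alone. *)
Lemma gauge_infE x y : Sigma x -> Sigma y -> gauge_inf C y x = (gauge_sup C x y)^-1.
Proof.
move=> Sx Sy; have s1 := gauge_sup_ge1 Sy Sx.
have s0 : 0 < gauge_sup C x y by lra.
have Cy := slice_cone Sy; have Cx := slice_cone Sx.
have hs : cone_le C ((gauge_sup C x y)^-1 *: x) y.
  have /(gauge_sup_le _ Sy Sx)/(cone_leZ C_proper (ltW _)) := lexx (gauge_sup C x y).
  by move=> /(_ (gauge_sup C x y)^-1); rewrite invr_gt0 scalerA mulVf ?gt_eqF// scale1r; exact.
have ub : ubound [set a | cone_le C (a *: x) y] (gauge_sup C x y)^-1.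
  move=> a /= ay; have [a0|a0] := leP a 0.
    by apply: (le_trans a0); rewrite invr_ge0 ltW.
  rewrite -[a]invrK lef_pV2 ?posrE ?invr_gt0//; apply/gauge_sup_le => //.
  have := cone_leZ C_proper _ ay => /(_ a^-1).
  by rewrite scalerA mulVf ?gt_eqF// scale1r invr_ge0 ltW//; exact.
apply/le_anti/andP; split; first by apply: ge_sup => //; exists (gauge_sup C x y)^-1.
by apply: ub_le_sup => //; exists (gauge_sup C x y)^-1.
Qed.

Lemma funk_le x y r : Sigma x -> Sigma y ->
  F x y <= r <-> cone_le C y (expR r *: x).
Proof.
move=> Sx Sy; rewrite -gauge_sup_le// /funk_metric -ler_expR lnK//.
by rewrite posrE (lt_le_trans ltr01)// gauge_sup_ge1.
Qed.

Lemma funk_le_ln x y b : Sigma x -> Sigma y -> cone_le C y (b *: x) -> F x y <= ln b.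
Proof.
move=> Sx Sy yb; apply/funk_le => //; rewrite lnK// posrE.
exact: lt_le_trans ltr01 (slice_le1 Sx Sy yb).
Qed.

Lemma funk_ge0 x y : Sigma x -> Sigma y -> 0 <= F x y.
Proof. by move=> Sx Sy; apply: ln_ge0; exact: gauge_sup_ge1. Qed.

Lemma funk_triangle y x z : Sigma x -> Sigma y -> Sigma z -> F x z <= F x y + F y z.
Proof.
move=> Sx Sy Sz; apply/funk_le => //; rewrite addrC expRD -scalerA.
have /(funk_le _ Sy Sz) yz := lexx (F y z).
have /(funk_le _ Sx Sy) xy := lexx (F x y).
by apply: (cone_le_trans C_proper yz); apply: cone_leZ => //; exact: expR_ge0.
Qed.

Lemma hilbert_metricE x y : Sigma x -> Sigma y -> hilbert_metric C x y = F x y + F y x.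
Proof.
move=> Sx Sy; rewrite /hilbert_metric gauge_infE// lnV ?opprK// posrE.
exact: lt_le_trans ltr01 (gauge_sup_ge1 Sy Sx).
Qed.

Lemma thompson_metricE x y : Sigma x -> Sigma y ->
  thompson_metric C x y = Num.max (F x y) (F y x).
Proof.
move=> Sx Sy; rewrite /thompson_metric gauge_infE// lnV ?opprK// posrE.
exact: lt_le_trans ltr01 (gauge_sup_ge1 Sy Sx).
Qed.

Lemma near_slice_funk x r : Sigma x -> 0 < r -> \forall z \near x,
  Sigma z -> F x z < r /\ F z x < r.
Proof.
(* With [1 + q = exp (r / 2)] the Funk distances are at most [r / 2], hence strictly below [r]. *)
move=> Sx r0; pose q := expR (r / 2) - 1.
have q0 : 0 < q by rewrite subr_gt0 expR_gt1; lra.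
have h : forall y z, Sigma y -> Sigma z -> cone_le C z ((1 + q) *: y) -> F y z < r.
  move=> y z Sy Sz; rewrite /q addrC subrK => /(funk_le _ Sy Sz) yz.
  by apply: (le_lt_trans yz); lra.
by apply: filterS (near_cone_le C_proper (proj1 Sx) q0) => z [z1 z2] Sz; split; apply: h.
Qed.

(* With [a = exp (- F x y)], the order inequality [a y <= x] becomes
   [(1 - k + k a) T y <= T x], where [T z = (1 - t) z + t p]; then
   [1 - k + k a >= a ^ k]. *)
Lemma funk_contraction p t L : Sigma p -> 0 < t < 1 -> 0 < L ->
  exists2 k, 0 <= k < 1 & forall x y, Sigma x -> Sigma y -> cone_le C y (L *: p) ->
    F ((1 - t) *: x + t *: p) ((1 - t) *: y + t *: p) <= k * F x y.
Proof.
move=> Sp /andP[t0 t1] L0.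
have den0 : 0 < (1 - t) * L + t by apply: addr_gt0 => //; apply: mulr_gt0; lra.
have Cp := slice_cone Sp.
(* This [k] solves [(1 - t) (1 - k) L = t k]: scaling by [1 - k (1 - a)] frees [t k (1 - a)] of the
   coefficient of [p], exactly what dominates the excess [(1 - t) (1 - k) (1 - a) *: y], as
   [y <= L *: p]. *)
exists ((1 - t) * L / ((1 - t) * L + t)).
  rewrite ltr_pdivrMr// mul1r ltrDl t0 andbT divr_ge0 ?(ltW den0)//.
  by rewrite mulr_ge0//; lra.
set k := _ / _ => x y Sx Sy yL.
have k0 : 0 <= k by rewrite divr_ge0 ?(ltW den0)// mulr_ge0//; lra.
have k1 : k < 1 by rewrite ltr_pdivrMr// mul1r ltrDl.
have kE : (1 - t) * (1 - k) * L = t * k by rewrite /k; field; rewrite gt_eqF.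
have F0 := funk_ge0 Sx Sy; set r := F x y in F0 *.
have ST z : Sigma z -> Sigma ((1 - t) *: z + t *: p).
  by move=> Sz; apply: slice_conv => //; [lra|exact: slice_cone|case: Sz].
apply/funk_le; [exact: ST|exact: ST|].
pose a := expR (- r); have a1 : a <= 1 by rewrite /a -expR0 ler_expR; lra.
pose al := 1 - k + k * a.
(* The bound [1 + s <= exp s], used at [k r] and at [k r - r] with weights [1 - k] and [k];
   everything but the constant 1 cancels. *)
have ekr : 1 <= expR (k * r) * al.
  rewrite /al mulrDr mulrCA -expRD.
  have := expR_ge1Dx (k * r); have := expR_ge1Dx (k * r + - r) => h1 h2.
  apply: (@le_trans _ _ ((1 + k * r) * (1 - k) + k * (1 + (k * r - r)))).
    by rewrite le_eqVlt; apply/orP; left; apply/eqP; ring.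
  by apply: lerD; [apply: ler_wpM2r => //; lra|apply: ler_wpM2l].
have ayx : cone_le C (a *: y) x.
  have /(funk_le _ Sx Sy)/(cone_leZ C_proper (expR_ge0 (- r))) := lexx r.
  by rewrite scalerA -expRD addNr expR0 scale1r.
have key : cone_le C (al *: ((1 - t) *: y + t *: p)) ((1 - t) *: x + t *: p).
  have -> : al *: ((1 - t) *: y + t *: p) =
      (1 - t) *: (a *: y) + (((1 - t) * (1 - k) * (1 - a)) *: y + (al * t) *: p).
    rewrite scalerDr !scalerA addrA -scalerDl; congr (_ *: _ + _); rewrite /al; ring.
  apply: cone_leD => //; first by apply: cone_leZ => //; lra.
  have -> : t *: p = ((1 - t) * (1 - k) * (1 - a)) *: (L *: p) + (al * t) *: p.
    by rewrite scalerA -scalerDl mulrAC kE; congr (_ *: _); rewrite /al; ring.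
  apply: cone_leD => //.
    by apply: cone_leZ => //; rewrite !mulr_ge0//; lra.
  by apply: cone_le_refl; rewrite -(scale0r p); apply: coneZ.
have := cone_leZ C_proper (expR_ge0 (k * r)) key; rewrite scalerA.
apply: cone_le_trans => //; rewrite -[X in cone_le _ X]scale1r.
by apply: cone_le_wZ => //; apply: slice_cone; exact: ST.
Qed.

End funk_metric_theory.

(** * Hilbert's and Thompson's metrics, treated together *)

Section projective_metric.
Context {R : realType} {X : normedModType R} {C : set X} {psi : {linear X -> R^o}}.
Context (C_normal : normal_cone C) (psi_dual : dual_cone C psi).
Context {d : X -> X -> R} (dE : d = hilbert_metric C \/ d = thompson_metric C).
Implicit Types (x y z : X) (a b c r t : R).

Local Notation Sigma := (slice C psi).
Local Notation F := (funk_metric C).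
Let C_proper : proper_cone C := proj1 C_normal.

Lemma projective_cases x y : Sigma x -> Sigma y ->
  d x y = F x y + F y x \/ d x y = Num.max (F x y) (F y x).
Proof.
move=> Sx Sy; case: dE => ->; [left|right].
  exact: (hilbert_metricE C_proper psi_dual).
exact: (thompson_metricE C_proper psi_dual).
Qed.

Lemma projectiveC x y : Sigma x -> Sigma y -> d x y = d y x.
Proof.
move=> Sx Sy; case: dE => ->; first by rewrite !(hilbert_metricE C_proper psi_dual)// addrC.
by rewrite !(thompson_metricE C_proper psi_dual)// maxC.
Qed.

Lemma projective_triangle y x z : Sigma x -> Sigma y -> Sigma z -> d x z <= d x y + d y z.
Proof.
move=> Sx Sy Sz.
have h1 := funk_triangle C_proper psi_dual Sx Sy Sz.
have h2 := funk_triangle C_proper psi_dual Sz Sy Sx.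
case: dE => ->; first by rewrite !(hilbert_metricE C_proper psi_dual)//; lra.
rewrite !(thompson_metricE C_proper psi_dual)// ge_max; apply/andP; split.
  by apply: (le_trans h1); apply: lerD; rewrite le_max lexx.
by apply: (le_trans h2); rewrite addrC; apply: lerD; rewrite le_max lexx orbT.
Qed.

Lemma funk_le_projective x y : Sigma x -> Sigma y -> F x y <= d x y /\ F y x <= d x y.
Proof.
move=> Sx Sy; have h1 := funk_ge0 C_proper psi_dual Sx Sy.
have h2 := funk_ge0 C_proper psi_dual Sy Sx.
case: (projective_cases Sx Sy) => ->; first by split; lra.
by rewrite !le_max !lexx orbT.
Qed.

Lemma projective_le_funk x y : Sigma x -> Sigma y -> d x y <= F x y + F y x.
Proof.
move=> Sx Sy; have h1 := funk_ge0 C_proper psi_dual Sx Sy.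
have h2 := funk_ge0 C_proper psi_dual Sy Sx.
case: (projective_cases Sx Sy) => -> //; rewrite ge_max; lra.
Qed.

Lemma near_slice_projective x r : Sigma x -> 0 < r ->
  \forall z \near x, Sigma z -> d x z < r.
Proof.
move=> Sx r0; have r20 : 0 < r / 2 by lra.
apply: filterS (near_slice_funk C_proper psi_dual Sx r20) => z h Sz.
have [h1 h2] := h Sz; apply: (le_lt_trans (projective_le_funk Sx Sz)).
by lra.
Qed.

(** Order bounds of [x] and [y] by multiples of [u] average to bounds for the convex combination.
    For Thompson's metric the averaged constants are again controlled by [exp r]; Hilbert's metric
    needs the upper and lower averages compared with each other. *)
Lemma projective_ball_convex u x y r t : 0 < t < 1 -> Sigma u -> Sigma x -> Sigma y ->
  d u x <= r -> d u y <= r -> d u ((1 - t) *: x + t *: y) <= r.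
Proof.
move=> /andP[t0 t1] Su Sx Sy dx dy; have Cu := slice_cone Su.
have Sz : Sigma ((1 - t) *: x + t *: y).
  by apply: (slice_conv C_proper) => //; [lra|exact: slice_cone Sx|by case: Sx].
set z := _ + _ in Sz *.
have upper p q : F u x <= p -> F u y <= q ->
    cone_le C z (((1 - t) * expR p + t * expR q) *: u).
  move=> /(funk_le C_proper psi_dual _ Su Sx) xp /(funk_le C_proper psi_dual _ Su Sy) yq.
  by rewrite scalerDl -!scalerA; apply: cone_leD => //; apply: cone_leZ => //; lra.
have lower p q : F x u <= p -> F y u <= q ->
    cone_le C u (((1 - t) * expR (- p) + t * expR (- q))^-1 *: z).
  move=> /(funk_le C_proper psi_dual _ Sx Su)/(cone_leZ C_proper (expR_ge0 (- p))).
  rewrite scalerA -expRD addNr expR0 scale1r => xp.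
  move=> /(funk_le C_proper psi_dual _ Sy Su)/(cone_leZ C_proper (expR_ge0 (- q))).
  rewrite scalerA -expRD addNr expR0 scale1r => yq.
  set A := (X in X^-1); have A0 : 0 < A.
    by apply: addr_gt0; apply: mulr_gt0; rewrite ?expR_gt0//; lra.
  have : cone_le C (A *: u) z.
    by rewrite scalerDl -!scalerA; apply: cone_leD => //; apply: cone_leZ => //; lra.
  move=> /(@cone_leZ _ _ _ C_proper A^-1); rewrite scalerA mulVf ?gt_eqF// scale1r.
  by apply; rewrite invr_ge0 ltW.
case: dE dx dy => ->.
  rewrite !(hilbert_metricE C_proper psi_dual)// => dx dy.
  have := funk_le_ln C_proper psi_dual Sz Su (lower _ _ (lexx _) (lexx _)).
  have := funk_le_ln C_proper psi_dual Su Sz (upper _ _ (lexx _) (lexx _)).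
  set B := (X in ln X); set A := (X in ln X^-1).
  have A0 : 0 < A by apply: addr_gt0; apply: mulr_gt0; rewrite ?expR_gt0//; lra.
  have B0 : 0 < B by apply: addr_gt0; apply: mulr_gt0; rewrite ?expR_gt0//; lra.
  rewrite lnV ?posrE// => h2 h1.
  (* [B <= exp r * A] holds term by term, since [exp (F u x) <= exp r * exp (- F x u)] and likewise
     for [y]. *)
  suff : ln B <= r + ln A by lra.
  rewrite -[r]expRK -lnM ?posrE ?expR_gt0// ler_ln ?posrE ?mulr_gt0 ?expR_gt0//.
  rewrite mulrDr; apply: lerD; rewrite mulrCA; apply: ler_wpM2l; rewrite -?expRD ?ler_expR; lra.
rewrite !(thompson_metricE C_proper psi_dual)// !ge_max => /andP[x1 x2] /andP[y1 y2].
apply/andP; split.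
  apply/(funk_le C_proper psi_dual) => //; have := upper _ _ x1 y1.
  by rewrite -mulrDl subrK mul1r.
apply/(funk_le C_proper psi_dual) => //; have := lower _ _ x2 y2.
by rewrite -mulrDl subrK mul1r expRN invrK.
Qed.

(** Both directions of the Funk metric contract with the same [k], hence so do their sum and their
    maximum; each direction uses one of the two bounds by [L *: p]. *)
Lemma projective_contraction p t L : Sigma p -> 0 < t < 1 -> 0 < L ->
  exists2 k, 0 <= k < 1 & forall x y, Sigma x -> Sigma y ->
    cone_le C x (L *: p) -> cone_le C y (L *: p) ->
    d ((1 - t) *: x + t *: p) ((1 - t) *: y + t *: p) <= k * d x y.
Proof.
move=> Sp t01 L0; have [k k01 kF] := funk_contraction C_proper psi_dual Sp t01 L0.
exists k => // x y Sx Sy xL yL; have /andP[t0 t1] := t01; have /andP[k0 k1] := k01.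
have ST z : Sigma z -> Sigma ((1 - t) *: z + t *: p).
  by move=> Sz; apply: (slice_conv C_proper) => //; [lra|exact: slice_cone Sz|by case: Sz].
have h1 := kF _ _ Sx Sy yL; have h2 := kF _ _ Sy Sx xL.
have Sx' := ST _ Sx; have Sy' := ST _ Sy.
case: dE => ->.
  by rewrite !(hilbert_metricE C_proper psi_dual)// mulrDr; exact: lerD.
rewrite !(thompson_metricE C_proper psi_dual)// maxr_pMr// ge_max !le_max.
by rewrite h1 h2 orbT.
Qed.

Lemma normal_coneP : exists2 M : R, 0 <= M &
  forall x y, C x -> cone_le C x y -> `|x| <= M * `|y|.
Proof.
have [_ [M CM]] := C_normal; exists `|M| => // x y Cx xy.
apply: (@le_trans _ _ (M * `|y|)); first by apply: CM; rewrite /cone_le ?subr0.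
by apply: ler_wpM2r => //; exact: ler_norm.
Qed.

(** Normality applied to [0 <= z <= exp r *: x]. *)
Lemma slice_norm_bound x : Sigma x -> exists B,
  forall r z, Sigma z -> d x z <= r -> `|z| <= expR r * B.
Proof.
move=> Sx; have [M M0 CM] := normal_coneP; exists (M * `|x|) => r z Sz dr.
have [h _] := funk_le_projective Sx Sz.
have /(funk_le C_proper psi_dual _ Sx Sz) zx := le_trans h dr.
by have := CM _ _ (slice_cone Sz) zx; rewrite normrZ gtr0_norm ?expR_gt0// mulrCA.
Qed.

(** From [exp (- r) *: x <= y <= exp r *: x], the vector [exp r *: x - y] lies between 0 and
    [(exp r - exp (- r)) *: x], so normality bounds its norm. The estimate is uniform for [x] in a
    norm ball. *)
Lemma projective_norm_small B e : 0 < e -> exists2 r, 0 < r & forall x y,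
  Sigma x -> Sigma y -> `|x| <= B -> d x y <= r -> `|y - x| < e.
Proof.
move=> e0; have [M M0 CM] := normal_coneP.
(* The final bound on the norm of [y - x], as a function of [r]; it vanishes at [r = 0]. *)
have lim : (expR r - 1 + M * (expR r - expR (- r))) * B @[r --> 0^'+] -->
    (expR 0 - 1 + M * (expR 0 - expR (- 0))) * B.
  apply: cvg_at_right_filter.
  apply: cvgMl; apply: cvgD; first by apply: cvgB; [exact: continuous_expR|exact: cvg_cst].
  apply: cvgMr; apply: cvgB; first exact: continuous_expR.
  by apply: cvg_comp; [apply: cvgN; exact: cvg_id|exact: continuous_expR].
rewrite oppr0 expR0 !subrr mulr0 addr0 mul0r in lim.
have near_lt : \forall r \near 0^'+, (expR r - 1 + M * (expR r - expR (- r))) * B < e.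
  exact: cvgr_lt lim _ e0.
have [r [r0 rB]] : exists r, 0 < r /\ (expR r - 1 + M * (expR r - expR (- r))) * B < e.
  near (0 : R)^'+ => r; exists r; split; first by near: r; exact: nbhs_right_gt.
  by near: r; exact: near_lt.
exists r => // x y Sx Sy xB dr.
have Cx := slice_cone Sx.
have [h1 h2] := funk_le_projective Sx Sy.
have yx : cone_le C y (expR r *: x) 
  by apply/(funk_le C_proper psi_dual _ Sx Sy); exact: le_trans dr.
have xy : cone_le C (expR (- r) *: x) y.
  have /(funk_le C_proper psi_dual _ Sy Sx)/(cone_leZ C_proper (expR_ge0 (- r))) :=
    le_trans h2 dr.
  by rewrite scalerA -expRD addNr expR0 scale1r.
have nb : `|expR r *: x - y| <= M * (expR r - expR (- r)) * `|x|.
  have rr : 0 <= expR r - expR (- r) by rewrite subr_ge0 ler_expR; lra.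
  rewrite -mulrA -[X in _ * (X * _)]ger0_norm// -normrZ.
  apply: CM => //.
  by rewrite /cone_le scalerBl opprB addrC addrA subrK.
have -> : y - x = (expR r - 1) *: x - (expR r *: x - y).
  by rewrite scalerBl scale1r opprB [RHS]addrC addrA subrK.
apply: le_lt_trans rB; apply: (le_trans (ler_normB _ _)).
have e1 : 0 <= expR r - 1 by rewrite subr_ge0 -expR0 ler_expR; lra.
rewrite normrZ ger0_norm//.
apply: (@le_trans _ _ ((expR r - 1 + M * (expR r - expR (- r))) * `|x|)).
  by rewrite [leRHS]mulrDl lerD2l.
apply: ler_wpM2l => //; apply: addr_ge0 => //; apply: mulr_ge0 => //.
by rewrite subr_ge0 ler_expR; lra.
Unshelve. all: by end_near. Qed.

End projective_metric.

(** * Approximate fixed points close to [v] *)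

Section approximate_fixed_points.
Context {R : realType} {X : normedModType R} {C : set X} {psi : {linear X -> R^o}}.
Context (C_normal : normal_cone C) (psi_dual : dual_cone C psi).
Context {d : X -> X -> R} (dE : d = hilbert_metric C \/ d = thompson_metric C).
Implicit Types (x y z p : X) (e r t : R).

Local Notation Sigma := (slice C psi).
Let C_proper : proper_cone C := proj1 C_normal.

(** Successive iterates of the damped map [T] become close in [d], hence in norm; what separates
    [T z] from [g z] is [t *: (g z - p)], small because [S] is bounded. *)
Lemma approximate_fixed_point (S : set X) (g : X -> X) p r e :
  S `<=` Sigma -> S p -> (forall z, S z -> d p z <= r) ->
  (forall t z, 0 < t < 1 -> S z -> S ((1 - t) *: z + t *: p)) ->
  (forall z, S z -> S (g z)) -> nonexpansive_on S d g -> 0 < e ->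
  exists2 z, S z & `|g z - z| < e.
Proof.
move=> SSigma Sp Sr Sconv Sg ge e0; have Sigp := SSigma _ Sp.
have [B0 zB0] := slice_norm_bound C_normal psi_dual dE Sigp.
pose B := expR r * B0.
have zB z : S z -> `|z| <= B by move=> Sz; apply: zB0; [exact: SSigma|exact: Sr].
have B_ge0 : 0 <= B := le_trans (normr_ge0 _) (zB _ Sp).
(* Chosen so that [t < 1] and [t * (2 B) < e / 2]. *)
pose t := e / (4 * B + e + 1).
have den0 : 0 < 4 * B + e + 1 by lra.
have t0 : 0 < t by rewrite divr_gt0.
have t1 : t < 1 by rewrite ltr_pdivrMr// mul1r; lra.
have tB : t * (B + B) < e / 2.
  rewrite /t mulrAC ltr_pdivrMr// mulrAC ltr_pdivlMr//.
  by rewrite -!mulrA ltr_pM2l//; lra.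
have t01 : 0 < t < 1 by rewrite t0.
(* [L = exp r] works on all of [S]: the radius bound gives [z <= exp r *: p]. *)
have [k /andP[k0 k1] kd] :=
  projective_contraction C_normal psi_dual dE Sigp t01 (expR_gt0 r).
have zp z : S z -> cone_le C z (expR r *: p).
  move=> Sz; have Sigz := SSigma _ Sz.
  apply/(funk_le C_proper psi_dual) => //.
  have [h _] := funk_le_projective C_normal psi_dual dE Sigp Sigz.
  exact: le_trans h (Sr _ Sz).
pose T z := (1 - t) *: g z + t *: p.
have ST z : S z -> S (T z) by move=> Sz; apply: Sconv => //; exact: Sg.
pose u n := iter n T p.
have Su n : S (u n) by elim: n => // n; exact: ST.
pose D := d (u 0%N) (u 1%N).
have du n : d (u n) (u n.+1) <= k ^+ n * D.
  elim: n => [|n IH]; first by rewrite expr0 mul1r.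
  have Sgn m : S (g (u m)) by exact: Sg.
  have := kd _ _ (SSigma _ (Sgn n)) (SSigma _ (Sgn n.+1))
    (zp _ (Sgn n)) (zp _ (Sgn n.+1)).
  move=> /le_trans; apply; rewrite exprS -mulrA; apply: ler_wpM2l => //.
  exact: le_trans (ge _ _ (Su n) (Su n.+1)) IH.
have e20 : 0 < e / 2 by lra.
have [r' r'0 small] := projective_norm_small C_normal psi_dual dE B e20.
have [n kn] : exists n, k ^+ n * D <= r'.
  have lim : k ^+ n * D @[n --> \oo] --> 0 * D.
    by apply: cvgMl; apply: cvg_expr; rewrite ger0_norm.
  rewrite mul0r in lim.
  have h : \forall n \near \oo, k ^+ n * D < r' by exact: cvgr_lt lim _ r'0.
  by have [n _ hn] := h; exists n; apply: ltW; apply: hn => /=.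
exists (u n) => //.
have h1 := small _ _ (SSigma _ (Su n)) (SSigma _ (Su n.+1))
  (zB _ (Su n)) (le_trans (du n) kn).
have -> : g (u n) - u n = (u n.+1 - u n) + t *: (g (u n) - p).
  have -> : u n.+1 = g (u n) - t *: (g (u n) - p).
    by rewrite /u iterS -/(u n) /T scalerBl scale1r scalerBr opprB addrA addrAC.
  by rewrite addrAC subrK.
apply: (le_lt_trans (ler_normD _ _)).
rewrite [ltRHS](splitr e); apply: ltrD => //; apply: le_lt_trans tB.
rewrite normrZ gtr0_norm// ler_pM2l//; apply: (le_trans (ler_normB _ _)).
by apply: lerD; apply: zB => //; exact: Sg.
Qed.

Lemma fixed_point_accumulation (U : set X) (g : X -> X) v w e :
  open U -> (forall x, Sigma x -> U x -> Sigma (g x)) ->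
  nonexpansive_on (Sigma `&` U) d g ->
  Sigma v -> U v -> g v = v -> Sigma w -> U w -> g w = w -> w <> v -> 0 < e ->
  exists z, [/\ Sigma z, U z, 0 < `|z - v| < e & `|g z - z| <= e * `|z - v|].
Proof.
move=> Uopen gSigma gnonexp Sv Uv gv Sw Uw gw wv e0.
(* [d] separates [v] from [w]: otherwise the norm estimate with tolerance [|v - w|] would give
   [|v - w| < |v - w|]. *)
have dwv : 0 < d w v.
  have nwv : 0 < `|v - w| by rewrite normr_gt0 subr_eq0 eq_sym; apply/eqP.
  have [r r0 small] := projective_norm_small C_normal psi_dual dE `|w| nwv.
  rewrite ltNge; apply/negP => dle.
  by have := small _ _ Sw Sv (lexx _) (le_trans dle (ltW r0)); rewrite ltxx.
have /nbhs_ballP[rho /= rho0 ballU] : nbhs v U by exact: open_nbhs_nbhs.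
have e'0 : 0 < Num.min e rho by rewrite lt_min e0.
(* One radius [r] around [v] ensures both the tolerance [e] and membership in [U]. *)
have [r r0 small] := projective_norm_small C_normal psi_dual dE `|v| e'0.
have near_v z : Sigma z -> d v z <= r -> `|z - v| < e /\ U z.
  move=> Sz /(small _ _ Sv Sz (lexx _)); rewrite lt_min => /andP[-> zr]; split=> //.
  by apply: ballU; rewrite -ball_normE /= distrC.
have [s [/andP[s0 s1] dp]] : exists s : R, 0 < s < 1 /\
    (Sigma ((1 - s) *: v + s *: w) -> d v ((1 - s) *: v + s *: w) < r).
  have lim : (1 - s) *: v + s *: w @[s --> (0 : R)^'+] --> (1 - 0) *: v + 0 *: w.
    apply: cvg_at_right_filter; apply: cvgD; apply: cvgZr_tmp; last exact: cvg_id.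
    by apply: cvgB; [exact: cvg_cst|exact: cvg_id].
  rewrite subr0 scale1r scale0r addr0 in lim.
  have h : \forall s \near 0^'+,
      Sigma ((1 - s) *: v + s *: w) -> d v ((1 - s) *: v + s *: w) < r.
    exact: lim _ (near_slice_projective C_normal psi_dual dE Sv r0).
  near (0 : R)^'+ => s; exists s; split; last by near: s; exact: h.
  by apply/andP; split; near: s; [exact: nbhs_right_gt|exact: nbhs_right_lt].
set p := (1 - s) *: v + s *: w in dp.
have Sp : Sigma p.
  by apply: (slice_conv C_proper) => //; [lra|exact: slice_cone Sv|case: Sv].
have {}dp := dp Sp.
(* The contraction with centre [w] and ratio [1 - s] fixes [w] and sends [v] to [p], so
   [d w p <= k * d w v]. *)
have dwp : d w p < d w v.
  have s01 : 0 < s < 1 by rewrite s0.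
  have [k /andP[k0 k1] kd] :=
    projective_contraction C_normal psi_dual dE Sw s01 (expR_gt0 (d w v)).
  have ww : cone_le C w (expR (d w v) *: w).
    rewrite -[X in cone_le _ X]scale1r; apply: cone_le_wZ => //; last exact: slice_cone Sw.
    by rewrite -expR0 ler_expR ltW.
  have vw : cone_le C v (expR (d w v) *: w).
    apply/(funk_le C_proper psi_dual _ Sw Sv).
    by have [] := funk_le_projective C_normal psi_dual dE Sw Sv.
  have := kd _ _ Sw Sv ww vw; rewrite -scalerDl subrK scale1r => /le_lt_trans; apply.
  by rewrite gtr_pMl.
(* The ball around [v] keeps [S] inside [U]; the ball around [w] excludes a neighborhood of [v].
   Both centres are fixed, so [g] preserves [S]. *)
pose S := [set z | Sigma z /\ (d v z <= d v p /\ d w z <= d w p)].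
have SU z : S z -> (Sigma `&` U) z.
  move=> [Sz [dvz _]]; split => //; have [] // := near_v _ Sz.
  exact: le_trans dvz (ltW dp).
have [eta eta0 far] : exists2 eta, 0 < eta & forall z, S z -> eta <= `|z - v|.
  have gap : 0 < d w v - d w p by rewrite subr_gt0.
  have /nbhs_ballP[eta /= eta0 close] :=
    near_slice_projective C_normal psi_dual dE Sv gap.
  exists eta => // z [Sz [_ dwz]]; rewrite leNgt; apply/negP => zv.
  have : d v z < d w v - d w p by apply: close => //; rewrite -ball_normE /= distrC.
  rewrite (projectiveC C_normal psi_dual dE Sv Sz).
  have := projective_triangle C_normal psi_dual dE Sw Sz Sv; lra.
(* As [eta <= |z - v|] on [S], the absolute tolerance [e * eta] yields the relative one
   [e * |z - v|]. *)
have [z Sz gz] : exists2 z, S z & `|g z - z| < e * eta.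
  apply: (@approximate_fixed_point S g p (d p v + d v p)).
  - by move=> z [].
  - by split.
  - move=> z [Sz [dvz _]].
    apply: (le_trans (projective_triangle C_normal psi_dual dE Sp Sv Sz)).
    by rewrite lerD2l.
  - move=> t z t01 [Sz [dvz dwz]]; split.
      have /andP[t0 t1] := t01.
      by apply: (slice_conv C_proper) => //; [lra|exact: slice_cone Sz|case: Sz].
    by split; apply: (projective_ball_convex C_normal psi_dual dE t01).
  - move=> z Sz; have [_ Uz] := SU _ Sz; have [Sigz [dvz dwz]] := Sz.
    split; first exact: gSigma.
    split; first by rewrite -{1}gv; apply: le_trans dvz; apply: gnonexp.
    by rewrite -{1}gw; apply: le_trans dwz; apply: gnonexp.
  - by move=> x y /SU Sx /SU Sy; exact: gnonexp.
  - exact: mulr_gt0.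
have zeta := far _ Sz; have [Sigz Uz] := SU _ Sz.
exists z; split => //.
  rewrite (lt_le_trans eta0 zeta)/=; have [_ [dvz _]] := Sz.
  by have [] := near_v _ Sigz (le_trans dvz (ltW dp)).
by apply: (le_trans (ltW gz)); rewrite ler_pM2l.
Unshelve. all: by end_near. Qed.

End approximate_fixed_points.

(** * Limits of normalized directions *)

Lemma increasing_seq_ge_id (k : nat -> nat) : increasing_seq k -> forall n, (n <= k n)%N.
Proof.
move=> kincr; elim=> // n IH; apply: (leq_ltn_trans IH).
by have := kincr n.+1 n; rewrite !leEnat ltnn => /negbT; rewrite -ltnNge.
Qed.

(** By homogeneity, [y - dg y] for the unit vector [y] along [x = z - v] is [x - dg x] divided by
    [|x|]. It tends to 0, so Property (F) yields a limit direction, fixed by continuity of [dg] on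
    the kernel. *)
Lemma semidifferential_fixed_direction (R : realType) (X : normedModType R)
    (psi : {linear X -> R^o}) (G : set X) (g dg : X -> X) (v : X) (z : nat -> X) :
  continuous psi ->
  semidifferential (psi @^-1` [set 0]) G g v dg -> g v = v ->
  property_F (psi @^-1` [set 0]) (fun x => x - dg x) ->
  (forall n, [/\ psi (z n) = psi v, 0 < `|z n - v| < n.+1%:R^-1 &
    `|g (z n) - z n| <= n.+1%:R^-1 * `|z n - v|]) ->
  exists l, [/\ psi l = 0, `|l| = 1 & dg l = l].
Proof.
move=> psi_cont [_ dg_cont dgZ /funext/eqoP dgo] gv phiF zP.
pose x n := z n - v; pose y n := `|x n|^-1 *: x n.
have x0 n : 0 < `|x n| by have [_ /andP[]] := zP n.
have Kx n : psi (x n) = 0 by have [pz _ _] := zP n; rewrite linearB pz subrr.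
have Ky n : psi (y n) = 0 by rewrite linearZ Kx; exact: scaler0.
have ny n : `|y n| = 1.
  by rewrite normrZ gtr0_norm ?invr_gt0// mulVf// gt_eqF.
have phi0 : (fun x => x - dg x) \o y @ \oo --> (0 : X).
  apply/cvgrPdist_le => /= e e0.
  have e20 : 0 < e / 2 by lra.
  have /nbhs_ballP[rho /= rho0 dgrho] := dgo _ e20.
  near=> n.
  have [_ /andP[_ xn] gz] := zP n.
  have n1 : n.+1%:R^-1 < rho by near: n; exact: near_infty_natSinv_lt (PosNum rho0).
  have n2 : n.+1%:R^-1 < e / 2 by near: n; exact: near_infty_natSinv_lt (PosNum e20).
  have gx : `|g (v + x n) - (g v + dg (x n))| <= e / 2 * `|x n|.
    by apply: dgrho => //; rewrite -ball_normE /= sub0r normrN; exact: lt_trans n1.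
  have -> : y n - dg (y n) = `|x n|^-1 *: (x n - dg (x n)).
    by rewrite /y dgZ ?invr_gt0//= -?scalerBr.
  rewrite sub0r normrN normrZ gtr0_norm ?invr_gt0// mulrC ler_pdivrMr//.
  have vx : v + x n = z n by rewrite addrC subrK.
  (* Since [g v = v], the displacement splits into the semidifferential remainder and the
     displacement of [z n], each at most [e / 2 * |x n|]. *)
  have -> : x n - dg (x n) = (g (v + x n) - (g v + dg (x n))) - (g (z n) - z n).
    by rewrite vx gv opprB [RHS]addrC addrA subrK opprD addrA.
  apply: (le_trans (ler_normB _ _)); rewrite [X in X * _](splitr e) mulrDl.
  apply: lerD => //; apply: (le_trans gz); apply: ler_wpM2r => //; exact: ltW.
have ybounded : bounded_fun y.
  by exists 1; split => // M M1 n _ /=; rewrite ny ltW.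
have [k /increasing_seq_ge_id kid /cvg_ex[l yl]] := phiF y Ky ybounded phi0.
have phik : (fun n => y (k n) - dg (y (k n))) @ \oo --> (0 : X).
  move=> P /phi0[N _ NP]; exists N => // n /= Nn; apply: NP => /=.
  exact: leq_trans Nn (kid n).
have nl : `|l| = 1.
  have h : `|(y \o k) n| @[n --> \oo] --> `|l| by exact: cvg_norm.
  rewrite (_ : (fun n => `|(y \o k) n|) = cst 1) in h; last by apply/funext => n /=.
  by have := cvg_unique _ h (cvg_cst _); exact.
have Kl : psi l = 0.
  have h : (psi ((y \o k) n) : R^o) @[n --> \oo] --> psi l.
    exact: (cvg_comp _ _ yl (psi_cont l)).
  rewrite (_ : (fun n => psi ((y \o k) n)) = cst 0) in h; last by apply/funext => n /=.
  by have := cvg_unique _ h (cvg_cst _); exact.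
(* [dg] is continuous only within the kernel of [psi], which contains every [y n] and [l]. *)
have dgl : dg ((y \o k) n) @[n --> \oo] --> dg l.
  have /subspace_continuousP/(_ l Kl) h := dg_cont.
  move=> P /h hP.
  have /= : \forall n \near \oo, psi ((y \o k) n) = 0 -> P (dg ((y \o k) n)).
    exact: yl _ hP.
  by apply: filterS => n; apply; exact: Ky.
exists l; split => //; apply/esym/eqP; rewrite -subr_eq0; apply/eqP.
have h : (y \o k) n - dg ((y \o k) n) @[n --> \oo] --> l - dg l by exact: cvgB.
by have := cvg_unique _ h phik; exact.
Unshelve. all: by end_near. Qed.

Theorem theorem7p3 (R : realType) (X : completeNormedModType R) (C : set X)
    (C_normal : normal_cone C) (intC_neq0 : C° !=set0)
    (psi : {linear X -> R^o}) (psi_dual : dual_cone C psi)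
    (psi_neq0 : ~ (psi =1 cst 0))
    (G : set X) (G_open : exists2 U : set X, open U & G = slice C psi `&` U)
    (g : X -> X) (g_slice : forall x, G x -> slice C psi (g x))
    (g_nonexp : nonexpansive_on G (hilbert_metric C) g \/
                nonexpansive_on G (thompson_metric C) g)
    (v : X) (Gv : G v) (gv : g v = v)
    (dg : X -> X)
    (A1 : semidifferential (psi @^-1` [set 0]) G g v dg)
    (A2 : property_F (psi @^-1` [set 0]) (fun x => x - dg x))
    (A3 : forall x, psi x = 0 -> dg x = x -> x = 0)
    (w : X) (Gw : G w) (gw : g w = w) :
  w = v.
Proof.
have [U Uopen GE] := G_open; subst G.
apply: contrapT => wv.
have [d [dE gnonexp]] : exists d, (d = hilbert_metric C \/ d = thompson_metric C) /\
    nonexpansive_on (slice C psi `&` U) d g.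
  by case: g_nonexp => h; eexists; (split; last exact: h); [left|right].
(* The single tolerance [1 / (n + 1)] makes the points converge to [v] and their relative
   displacements vanish. *)
have step n : exists z, [/\ slice C psi z, U z, 0 < `|z - v| < n.+1%:R^-1 &
    `|g z - z| <= n.+1%:R^-1 * `|z - v|].
  case: Gv => Sv Uv; case: Gw => Sw Uw.
  apply: (fixed_point_accumulation C_normal psi_dual dE Uopen _ gnonexp Sv Uv gv Sw Uw gw wv).
    by move=> x Sx Ux; exact: g_slice.
  by rewrite invr_gt0.
have [z zP] := choice step.
have [|l [Kl nl dgl]] :=
    semidifferential_fixed_direction (proj1 psi_dual) A1 gv A2 (z := z).
  move=> n; have [[_ pz] _ zv gz] := zP n; split => //.
  by case: Gv => -[_ ->].
by move: nl; rewrite (A3 l Kl dgl) normr0 => /esym/eqP; rewrite oner_eq0.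
Qed.
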